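(* Let $f\in\mathbb{Z}AA(\mathbb{R};\mathbb{C}^p)$ and let $A,B\in M_{p\times p}(\mathbb{R})$ be simultaneously triangularizable. Suppose that the eigenvalues $\lambda_A$ of $A$ and $\lambda_B$ of $B$ satisfy, for all $u\in[0,1]$, $$\begin{cases}\dfrac{\lambda_B}{\lambda_A}\left[1-e^{-u\lambda_A}\right]\neq -1, & \text{if }\lambda_A\neq 0,\\[2mm] \lambda_B u\neq -1, & \text{if }\lambda_A=0.\end{cases}$$ Let $x:\mathbb{R}\to\mathbb{C}^p$ be a bounded solution on $\mathbb{R}$ of $$x'(t)=Ax(t)+Bx([t])+f(t).$$ Then $x$ is almost automorphic if and only if the sequence $(x(n))_{n\in\mathbb{Z}}$ is discrete almost automorphic.
   Context: $[\cdot]$ denotes the greatest integer function. Matrices $A,B$ are simultaneously triangularizable if there is an invertible (complex) matrix $T$ such that $T^{-1}AT$ and $T^{-1}BT$ are both upper triangular. $BPC(\mathbb{R};\mathbb{C}^p)$ is the space of bounded functions $\mathbb{R}\to\mathbb{C}^p$ that are continuous on $\mathbb{R}\setminus\mathbb{Z}$ and have finite lateral limits at each integer. A function $f\in BPC(\mathbb{R};\mathbb{C}^p)$ is $\mathbb{Z}$-almost automorphic, written $f\in\mathbb{Z}AA(\mathbb{R};\mathbb{C}^p)$, if for any sequence of integers $\{s_n'\}_{n\in\mathbb{N}}$ there exist a subsequence $\{s_n\}_{n\in\mathbb{N}}$ of $\{s_n'\}$ and a function $\tilde f$ such that, pointwise, $\lim_{n\to\infty}f(t+s_n)=\tilde f(t)$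 and $\lim_{n\to\infty}\tilde f(t-s_n)=f(t)$ for every $t\in\mathbb{R}$. A bounded continuous function $f:\mathbb{R}\to\mathbb{C}^p$ is almost automorphic if for any sequence of real numbers $\{s_n'\}$ there exist a subsequence $\{s_n\}$ and a function $\tilde f$ such that the same two pointwise limits hold for every $t\in\mathbb{R}$. A function $u:\mathbb{Z}\to\mathbb{C}^p$ is discrete almost automorphic if for any sequence of integers $\{s_n'\}$ there exist a subsequence $\{s_n\}$ and $\tilde u:\mathbb{Z}\to\mathbb{C}^p$ with $\lim_{n\to\infty}u(k+s_n)=\tilde u(k)$ and $\lim_{n\to\infty}\tilde u(k-s_n)=u(k)$ for every $k\in\mathbb{Z}$. A function $x$ is a solution on $\mathbb{R}$ of the equation if (i) $x$ is continuous on $\mathbb{R}$; (ii) $x$ is differentiable on $\mathbb{R}$ except possibly at the points $n\in\mathbb{Z}$, where there should be a lateral derivative; (iii) $x$ satisfies the equation on each open interval $]n,n+1[$, $n\in\mathbb{Z}$, and the equation is also satisfied by the right-hand derivative of $x$ at each $n\in\mathbb{Z}$. *)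

(* Defs.v *)
From HB Require Import structures.
From mathcomp Require Import all_boot all_order all_algebra.
From mathcomp Require Import complex.
From mathcomp Require Import all_classical all_reals all_analysis.

Set Implicit Arguments.
Unset Strict Implicit.
Unset Printing Implicit Defensive.

Import Order.TTheory GRing.Theory Num.Theory.
Import numFieldNormedType.Exports.

Local Open Scope classical_set_scope.
Local Open Scope ring_scope.
Local Open Scope complex_scope.

(* [R[i]] gets the topology of its modulus; ['cV[R[i]]_p] then inherits the
   sup-norm structure of matrix_normedtype. *)
HB.instance Definition _ (R : realType) := NormedModule.copy R[i] R[i]^o.

Definition cexp (R : realType) (z : R[i]) : R[i] :=
  (expR (complex.Re z))%:C *
  (cos (complex.Im z) +i* sin (complex.Im z)).

(* [is_trig_mx] is lower triangularity in MathComp, hence this definition. *)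
Definition upper_triangular (K : nmodType) p (M : 'M[K]_p) : Prop :=
  forall i j : 'I_p, (j < i)%N -> M i j = 0.

Definition simultaneously_triangularizable (K : fieldType) p
    (A B : 'M[K]_p) : Prop :=
  exists T : 'M[K]_p, [/\ T \in unitmx,
    upper_triangular (invmx T *m A *m T) &
    upper_triangular (invmx T *m B *m T)].

Definition complex_mx (R : realType) p (A : 'M[R]_p) : 'M[R[i]]_p :=
  map_mx (real_complex R) A.

Section AlmostAutomorphy.
Context {R : realType} {p : nat}.
Implicit Types f x : R -> 'cV[R[i]]_p.

Definition BPC f : Prop :=
  [/\ bounded_fun f,
      forall t : R, t \isn't a Num.int -> {for t, continuous f} &
      forall n : int,
        (exists l : 'cV[R[i]]_p, f t @[t --> (n%:~R : R)^'-] --> l) /\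
        (exists l : 'cV[R[i]]_p, f t @[t --> (n%:~R : R)^'+] --> l)].

Definition Z_almost_automorphic f : Prop :=
  BPC f /\
  forall s' : nat -> int, exists (phi : nat -> nat) (ft : R -> 'cV[R[i]]_p),
    let s n := s' (phi n) in
    [/\ increasing_seq phi,
        forall t, f (t + (s n)%:~R) @[n --> \oo] --> ft t &
        forall t, ft (t - (s n)%:~R) @[n --> \oo] --> f t].

Definition almost_automorphic f : Prop :=
  [/\ bounded_fun f, continuous f &
  forall s' : nat -> R, exists (phi : nat -> nat) (ft : R -> 'cV[R[i]]_p),
    let s n := s' (phi n) in
    [/\ increasing_seq phi,
        forall t, f (t + s n) @[n --> \oo] --> ft t &
        forall t, ft (t - s n) @[n --> \oo] --> f t]].

Definition discrete_almost_automorphic (u : int -> 'cV[R[i]]_p) : Prop :=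
  forall s' : nat -> int, exists (phi : nat -> nat) (ut : int -> 'cV[R[i]]_p),
    let s n := s' (phi n) in
    [/\ increasing_seq phi,
        forall k, u (k + s n) @[n --> \oo] --> ut k &
        forall k, ut (k - s n) @[n --> \oo] --> u k].

(* [derivable] needs the domain and the codomain to be normed modules over the
   same field; here the variable is real and the values are complex. *)
Definition diff_quotient x (t h : R) : 'cV[R[i]]_p :=
  (h^-1)%:C *: (x (t + h) - x t).

Definition has_derivative x (t : R) (l : 'cV[R[i]]_p) : Prop :=
  diff_quotient x t h @[h --> (0 : R)^'] --> l.

Definition has_right_derivative x (t : R) (l : 'cV[R[i]]_p) : Prop :=
  diff_quotient x t h @[h --> (0 : R)^'+] --> l.

Definition has_left_derivative x (t : R) (l : 'cV[R[i]]_p) : Prop :=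
  diff_quotient x t h @[h --> (0 : R)^'-] --> l.

Definition DEPCA_rhs (A B : 'M[R[i]]_p) f x (t : R) : 'cV[R[i]]_p :=
  A *m x t + B *m x (Num.floor t)%:~R + f t.

Definition DEPCA_solution (A B : 'M[R[i]]_p) f x : Prop :=
  [/\ continuous x,
      forall t : R, t \isn't a Num.int -> exists l, has_derivative x t l,
      forall n : int, (exists l, has_left_derivative x n%:~R l) \/
                      (exists l, has_right_derivative x n%:~R l),
      forall (n : int) (t : R), n%:~R < t < (n + 1)%:~R ->
        has_derivative x t (DEPCA_rhs A B f x t) &
      forall n : int,
        has_right_derivative x n%:~R (DEPCA_rhs A B f x n%:~R)].

End AlmostAutomorphy.

(* Main.v *)
Require Import Defs.
From HB Require Import structures.
From mathcomp Require Import all_boot all_order all_algebra.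
From mathcomp Require Import complex.
From mathcomp Require Import all_classical all_reals all_analysis.
From mathcomp Require Import measurable_realfun.
From mathcomp Require Import ring lra.

(** One implication is immediate: restrict the limits along integer shifts to
    integer points.

    For the converse, the equation is an ordinary differential equation on each
    cell [[n, n + 1]], since [x [t]] is there the constant [x n].  Grönwall's
    inequality yields a constant [C] such that, for all integers [a], [b] and
    all [t] in [[0, 1]],
      [|x (t + a) - x (t + b)|^2
         <= C (|x a - x b|^2 + \int_0^1 |f (s + a) - f (s + b)|^2 ds)]
    ([solution_stability]).  Along integers [m j] for which [f (t + m j)] and
    [x (k + m j)] converge, the integrals converge by dominated convergence, so
    [x (t + m j)] is Cauchy and tends to some [y t]; passing to the limit in the
    same estimate shows that [y (t - m j)] tends to [x t]
    ([solution_integer_shift]).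

    Arbitrary real shifts are reduced to integer ones by compactness of the
    fractional parts.  Their variation is absorbed by the Lipschitz continuity
    of [x], whose derivative is bounded ([solution_lipschitz],
    [lipschitz_almost_automorphic]). *)

Import Order.TTheory GRing.Theory Num.Theory.
Import numFieldNormedType.Exports.

Local Open Scope classical_set_scope.
Local Open Scope ring_scope.
Local Open Scope complex_scope.

Set Implicit Arguments.
Unset Strict Implicit.
Unset Printing Implicit Defensive.

(** * Real coordinates of complex vectors *)

Lemma sqrD_le {R : realDomainType} (x y : R) :
  (x + y) ^+ 2 <= 2 * x ^+ 2 + 2 * y ^+ 2.
Proof.
rewrite -subr_ge0.
have -> : 2 * x ^+ 2 + 2 * y ^+ 2 - (x + y) ^+ 2 = (x - y) ^+ 2 by ring.
exact: sqr_ge0.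
Qed.

Lemma cvg_sum_fin {R : realType} {I : finType} {T} (F : set_system T)
    {FF : Filter F} (f : I -> T -> R) (l : I -> R) :
  (forall i, f i t @[t --> F] --> l i) ->
  \sum_i f i t @[t --> F] --> \sum_i l i.
Proof.
move=> fl; elim: (index_enum I) => [|i s IH].
  by rewrite big_nil; under eq_fun do rewrite big_nil; exact: cvg_cst.
by rewrite big_cons; under eq_fun do rewrite big_cons; exact: cvgD.
Qed.

Lemma cvg_sqr {R : realType} {T} (F : set_system T) {FF : Filter F}
    (f : T -> R) (l : R) :
  f t @[t --> F] --> l -> f t ^+ 2 @[t --> F] --> l ^+ 2.
Proof. by move=> fl; under eq_fun do rewrite expr2; exact: cvgM. Qed.

Section Coordinates.
Context {R : realType} {p : nat}.
Implicit Types (u v w : 'cV[R[i]]_p) (c : bool * 'I_p).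

(** [rcoord] and [sqnorm] move the whole argument into [R]: derivatives with
    respect to a real variable, measurability, Lebesgue integrals and
    completeness are used for real-valued functions only.  The square of the
    Euclidean norm, unlike the sup norm, is differentiable. *)
Definition rcoord c v : R :=
  if c.1 then complex.Re (v c.2 0) else complex.Im (v c.2 0).

Definition sqnorm v : R := \sum_c rcoord c v ^+ 2.

Lemma rcoordD c u v : rcoord c (u + v) = rcoord c u + rcoord c v.
Proof. by rewrite /rcoord !mxE; case: (u _ _) (v _ _) => ? ? [? ?]; case: c.1. Qed.

Lemma rcoordN c v : rcoord c (- v) = - rcoord c v.
Proof. by rewrite /rcoord !mxE; case: (v _ _) => ? ?; case: c.1. Qed.

Lemma rcoordB c u v : rcoord c (u - v) = rcoord c u - rcoord c v.
Proof. by rewrite rcoordD rcoordN. Qed.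

Lemma rcoordZ c (r : R) v : rcoord c (r%:C *: v) = r * rcoord c v.
Proof.
rewrite /rcoord !mxE; case: (v _ _) => a b.
by case: c.1; rewrite /= mul0r ?subr0 ?addr0.
Qed.

Lemma sqnorm_ge0 v : 0 <= sqnorm v.
Proof. by apply: sumr_ge0 => c _; exact: sqr_ge0. Qed.

Lemma sqnorm0 : sqnorm 0 = 0.
Proof.
by apply: big1 => c _; rewrite /rcoord mxE; case: c.1; rewrite /= expr0n.
Qed.

Lemma sqr_rcoord_le c v : rcoord c v ^+ 2 <= sqnorm v.
Proof.
rewrite /sqnorm (bigD1 c)//= lerDl.
by apply: sumr_ge0 => d _; exact: sqr_ge0.
Qed.

Lemma sqnormE v :
  sqnorm v = \sum_i (complex.Re (v i 0) ^+ 2 + complex.Im (v i 0) ^+ 2).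
Proof.
rewrite /sqnorm -(pair_bigA _ (fun b i => rcoord (b, i) v ^+ 2)) /=.
by rewrite big_bool /= -big_split.
Qed.

Lemma sqnormN v : sqnorm (- v) = sqnorm v.
Proof. by apply: eq_bigr => c _; rewrite rcoordN sqrrN. Qed.

Lemma sqnormBC u v : sqnorm (u - v) = sqnorm (v - u).
Proof. by rewrite -sqnormN opprB. Qed.

Lemma sqnormD_le u v : sqnorm (u + v) <= 2 * sqnorm u + 2 * sqnorm v.
Proof.
rewrite !mulr_sumr -big_split; apply: ler_sum => c _ /=.
by rewrite rcoordD sqrD_le.
Qed.

Lemma sqnormB_le u v w :
  sqnorm (u - w) <= 2 * sqnorm (u - v) + 2 * sqnorm (v - w).
Proof. by rewrite -[u - w](subrKA v) sqnormD_le. Qed.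

(** Only the existence of a constant matters below, so each row is bounded
    crudely, by induction on the list of columns with [sqrD_le]. *)
Lemma sqnorm_mulmx_le (M : 'M[R[i]]_p) :
  exists2 K, 0 <= K & forall v, sqnorm (M *m v) <= K * sqnorm v.
Proof.
have /boolp.choice[z zP] : forall i : 'I_p, exists r : R,
    0 <= r /\ forall v, complex.Re ((M *m v) i 0) ^+ 2 +
      complex.Im ((M *m v) i 0) ^+ 2 <= r * sqnorm v.
  move=> i.
  suff [K K0 KP] : exists2 K, 0 <= K & forall v,
      complex.Re (\sum_j M i j * v j 0) ^+ 2 +
      complex.Im (\sum_j M i j * v j 0) ^+ 2 <= K * sqnorm v.
    by exists K; split => // v; rewrite mxE KP.
  elim: (index_enum _) => [|j s [K K0 KP]].
    by exists 0 => // v; rewrite big_nil /= mul0r expr0n addr0.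
  case Eij: (M i j) => [a b].
  exists (2 * (a ^+ 2 + b ^+ 2) + 2 * K) => [|v].
    by rewrite addr_ge0// mulr_ge0// addr_ge0// sqr_ge0.
  rewrite big_cons Eij.
  have := KP v; case: (\sum_(_ <- _) _) => c d /=.
  have : complex.Re (v j 0) ^+ 2 + complex.Im (v j 0) ^+ 2 <= sqnorm v.
    rewrite sqnormE (bigD1 j)//= lerDl.
    by apply: sumr_ge0 => k _; rewrite addr_ge0// sqr_ge0.
  case: (v j 0) => e f /=; set S := sqnorm v => vS cdS.
  have ab0 : 0 <= a ^+ 2 + b ^+ 2 by rewrite addr_ge0// sqr_ge0.
  have /= := ler_wpM2l ab0 vS.
  set x := a * e - b * f; set y := a * f + b * e.
  have -> : (a ^+ 2 + b ^+ 2) * (e ^+ 2 + f ^+ 2) = x ^+ 2 + y ^+ 2.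
    by rewrite /x /y; ring.
  clearbody x y => xyS.
  have := sqrD_le x c; have := sqrD_le y d.
  lra.
exists (\sum_i z i) => [|v]; first by apply: sumr_ge0 => i _; have [] := zP i.
rewrite [leLHS]sqnormE mulr_suml; apply: ler_sum => i _.
by have [_] := zP i; exact.
Qed.

Lemma norm_entry_le v i : `|v i 0| <= `|v|.
Proof.
rewrite [leRHS]/Num.norm /= mx_normE.
rewrite -[leLHS]/(NngNum (normr_ge0 (v i ord0)))%:num num_le.
by apply/bigmax_geP; right; exists (i, ord0) => //; rewrite -num_le /= lexx.
Qed.

Lemma sqr_normc (z : R[i]) :
  complex.Re `|z| ^+ 2 = complex.Re z ^+ 2 + complex.Im z ^+ 2.
Proof. by rewrite normc_def /= sqr_sqrtr// addr_ge0// sqr_ge0. Qed.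

Lemma sqnorm_le_norm v (r : R) : `|v| <= r%:C -> sqnorm v <= p%:R * r ^+ 2.
Proof.
move=> vr; rewrite sqnormE mulr_natl -[X in _ *+ X]card_ord -sumr_const.
apply: ler_sum => i _; rewrite -sqr_normc.
have := le_trans (norm_entry_le v i) vr.
rewrite {1}normc_def lecR => ir.
rewrite normc_def /=; apply: lerXn2r; rewrite // nnegrE ?sqrtr_ge0//.
by rewrite (le_trans _ ir)// sqrtr_ge0.
Qed.

Lemma norm_lt_sqnorm v (e : R) : 0 < e -> sqnorm v < e ^+ 2 -> `|v| < e%:C.
Proof.
move=> e0 ve.
have eC0 : 0 < e%:C by rewrite ltcR.
rewrite [ltLHS]/Num.norm /= mx_normE -[ltRHS]/(NngNum (ltW eC0))%:num num_lt.
apply/bigmax_ltP; split; first by rewrite -num_lt.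
move=> [i j] _; rewrite -num_lt /= ord1 normc_def ltcR.
rewrite -(@ltr_pXn2r _ 2)// ?nnegrE ?sqrtr_ge0 ?(ltW e0)// sqr_sqrtr.
  apply: le_lt_trans ve; rewrite sqnormE (bigD1 i)//= lerDl.
  by apply: sumr_ge0 => k _; rewrite addr_ge0// sqr_ge0.
by rewrite addr_ge0// sqr_ge0.
Qed.

(** All norms on a finite-dimensional space define the same convergence:
    [sqnorm_le_norm] and [norm_lt_sqnorm] compare [sqnorm] with the sup norm,
    whose values live in [R[i]]. *)
Lemma cvg_sqnormP {T} (F : set_system T) {FF : Filter F} (u : T -> 'cV[R[i]]_p) v :
  u t @[t --> F] --> v <-> sqnorm (u t - v) @[t --> F] --> 0.
Proof.
split=> [/cvgrPdist_lt uv|/cvgr0Pnorm_lt uv].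
  apply/cvgr0Pnorm_le => e e0.
  (* [p.+1] rather than [p], so that the division is harmless for [p = 0]. *)
  pose d := Num.sqrt (e / p.+1%:R).
  have d0 : 0 < d by rewrite sqrtr_gt0 divr_gt0.
  have dC0 : 0 < d%:C by rewrite ltcR.
  near=> t; rewrite ger0_norm ?sqnorm_ge0// sqnormBC.
  have : `|v - u t| < d%:C by near: t; exact: uv.
  move=> /ltW /sqnorm_le_norm /le_trans; apply.
  rewrite sqr_sqrtr ?divr_ge0 ?(ltW e0)// mulrCA ler_piMr ?(ltW e0)//.
  by rewrite ler_pdivrMr// mul1r ler_nat.
apply/cvgrPdist_lt => e e0.
have -> : e = (complex.Re e)%:C by rewrite RRe_real// gtr0_real.
move: e0; rewrite ltcE /= => /andP[_ e0].
have e20 : 0 < complex.Re e ^+ 2 by rewrite exprn_gt0.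
near=> t; apply: norm_lt_sqnorm => //.
rewrite sqnormBC -[ltLHS]ger0_norm ?sqnorm_ge0//.
by near: t; exact: uv.
Unshelve. all: by end_near. Qed.

Lemma cvg_sqnorm_le {T} (F : set_system T) {FF : Filter F}
    (u : T -> 'cV[R[i]]_p) v (r : T -> R) :
  r t @[t --> F] --> 0 -> (forall t, sqnorm (u t - v) <= r t) ->
  u t @[t --> F] --> v.
Proof.
move=> r0 ur; apply/cvg_sqnormP.
apply: (squeeze_cvgr _ (cvg_cst 0) r0); apply: nearW => t.
by rewrite sqnorm_ge0 ur.
Qed.

Lemma cvg_rcoord {T} (F : set_system T) {FF : Filter F} (u : T -> 'cV[R[i]]_p) v :
  u t @[t --> F] --> v -> forall c, rcoord c (u t) @[t --> F] --> rcoord c v.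
Proof.
move=> /cvg_sqnormP /cvgr0Pnorm_lt uv c; apply/cvgrPdist_lt => e e0.
have e20 : 0 < e ^+ 2 by rewrite exprn_gt0.
near=> t; rewrite distrC -rcoordB -(@ltr_pXn2r _ 2)// ?nnegrE ?(ltW e0)//.
rewrite real_normK ?num_real//; apply: le_lt_trans (sqr_rcoord_le c _) _.
by rewrite -[ltLHS]ger0_norm ?sqnorm_ge0//; near: t; exact: uv.
Unshelve. all: by end_near. Qed.

Lemma cvg_sqnorm {T} (F : set_system T) {FF : Filter F} (u : T -> 'cV[R[i]]_p) v :
  u t @[t --> F] --> v -> sqnorm (u t) @[t --> F] --> sqnorm v.
Proof.
by move=> /cvg_rcoord uv; apply: cvg_sum_fin => c; exact: cvg_sqr.
Qed.

Lemma rcoord_cvg {T} (F : set_system T) {FF : Filter F} (u : T -> 'cV[R[i]]_p) v :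
  (forall c, rcoord c (u t) @[t --> F] --> rcoord c v) -> u t @[t --> F] --> v.
Proof.
move=> uv; apply/cvg_sqnormP; rewrite -{1}sqnorm0 -(subrr v).
apply: cvg_sum_fin => c; apply: cvg_sqr; rewrite rcoordB.
under eq_fun do rewrite rcoordB.
by apply: cvgB; [exact: uv|exact: cvg_cst].
Qed.

Lemma exists_rcoord (z : bool * 'I_p -> R) :
  exists v, forall c, rcoord c v = z c.
Proof.
exists (\col_i (z (true, i) +i* z (false, i))) => -[[] i];
  by rewrite /rcoord mxE.
Qed.

Lemma bounded_sqnorm {T} (f : T -> 'cV[R[i]]_p) :
  bounded_fun f -> exists2 M, 0 <= M & forall t, sqnorm (f t) <= M.
Proof.
move=> [M [Mreal fM]].
have M1 : M < (complex.Re M + 1)%:C.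
  by rewrite -[ltLHS]RRe_real// ltcR ltrDl.
exists (p%:R * (complex.Re M + 1) ^+ 2) => [|t].
  by rewrite mulr_ge0// sqr_ge0.
by apply: sqnorm_le_norm; exact: (fM _ M1 t I).
Qed.

End Coordinates.

(** * Integrals and differential inequalities on the unit interval *)

Section UnitInterval.
Context {R : realType}.
Notation mu := (@lebesgue_measure R).
Implicit Types (V dV g : R -> R).

Lemma integrable_unit g (M : R) : measurable_fun `[0 : R, 1] g ->
  (forall s, `|g s| <= M) -> mu.-integrable `[0 : R, 1] (EFin \o g).
Proof.
move=> mg gM; apply: measurable_bounded_integrable => //.
  by rewrite /= lebesgue_measure_itv /= lte01 oppr0 adde0 ltry.
by exists M; split; rewrite ?num_real// => N MN s _; apply: le_trans (gM s) (ltW MN).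
Qed.

(** Dominated convergence with a constant as dominating function, which is
    integrable because the interval is bounded. *)
Lemma bounded_cvg_unit (G : nat -> R -> R) g (M : R) :
  (forall n, measurable_fun `[0 : R, 1] (G n)) ->
  (forall n s, `|G n s| <= M) ->
  (forall s, G n s @[n --> \oo] --> g s) ->
  \int[mu]_(s in `[0 : R, 1]) G n s @[n --> \oo] --> \int[mu]_(s in `[0 : R, 1]) g s.
Proof.
move=> mG GM Gg; apply: fine_cvg.
have mg : measurable_fun `[0 : R, 1] g.
  by apply: (measurable_fun_cvg mG) => s _; exact: Gg.
have gM s : `|g s| <= M.
  apply: (ler_cvg_to (cvg_norm (Gg s)) (cvg_cst M)).
  by near=> n; exact: GM.
rewrite /Rintegral fineK; last exact: integrable_fin_num (integrable_unit mg gM).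
apply: (@dominated_cvg _ _ _ mu _ _ (fun n s => (G n s)%:E) _ (cst M%:E)) => //.
- by move=> n; apply/measurable_EFinP; exact: mG.
- by move=> s _; apply: cvg_EFin; [near=> n|exact: Gg].
- exact: (@integrable_unit (cst M) `|M|).
- by move=> n s _; rewrite lee_fin; exact: GM.
Unshelve. all: by end_near. Qed.

(** Grönwall's inequality: [V t * exp (- K t) - \int_0^t g] is nonincreasing,
    because its derivative is at most [(exp (- K t) - 1) * g t].  Only
    the open interval is constrained by the derivative of [V] and the continuity
    of [g], since the forcing term of the equation may jump at both endpoints. *)
Lemma gronwall_unit V dV g (K : R) :
  0 <= K -> 0 <= V 0 ->
  {within `[0, 1], continuous V} ->
  (forall t : R, t \in `]0, 1[ -> is_derive t 1 V (dV t)) ->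
  (forall t : R, t \in `]0, 1[ -> dV t <= K * V t + g t) ->
  (forall t, 0 <= g t) ->
  (forall t : R, t \in `]0, 1[ -> {for t, continuous g}) ->
  mu.-integrable `[0 : R, 1] (EFin \o g) ->
  forall t : R, 0 <= t <= 1 ->
    V t <= expR K * (V 0 + \int[mu]_(s in `[0 : R, 1]) g s).
Proof.
move=> K0 V0 cV dVE dVle g0 cg ig t t01.
pose G (t : R) := \int[mu]_(s in `[0, t]) g s.
pose W (t : R) := expR (- K * t) * V t - G t.
have dG (s : R) : s \in `]0, 1[ -> is_derive s 1 G (g s).
  move=> s01; have /andP[s0 s1] : 0 < s < 1 by rewrite in_itv in s01.
  have [dG <-] := continuous_FTC1_closed s1 ig s0 (cg _ s01).
  by rewrite derive1E; exact: derivableP.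
have dW (s : R) : s \in `]0, 1[ ->
    is_derive s 1 W (expR (- K * s) * (dV s - K * V s) - g s).
  move=> s01; have := dG _ s01; have := dVE _ s01 => ? ?.
  apply: is_derive_eq; rewrite /GRing.scale /=; ring.
have W'_exists (s : R) : s \in `]0, 1[ -> derivable W s 1 by move=> /dW[].
have W'_le0 (s : R) : s \in `]0, 1[ -> derive1 W s <= 0.
  move=> s01; rewrite derive1E (derive_val (is_derive := dW _ s01)).
  have e1 : expR (- K * s) <= 1.
    rewrite -expR0 ler_expR mulNr oppr_le0 mulr_ge0//.
    by move: s01; rewrite in_itv => /andP[/ltW].
  have := dVle _ s01; rewrite -lerBlDl => /(ler_wpM2l (expR_ge0 (- K * s))).
  rewrite subr_le0 => /le_trans; apply.
  by rewrite ler_piMl.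
have cW : {within `[0, 1], continuous W}.
  move=> s; apply: cvgB; last exact: parameterized_integral_continuous.
  apply: cvgM; last exact: cV.
  apply: continuous_subspaceT => {}s.
  apply: (continuous_comp (g := expR)); first exact: mulrl_continuous.
  exact: continuous_expR.
have W0 : W t <= W 0.
  have i0 : (0 : R) \in `[0, 1] by rewrite in_itv /= lexx ler01.
  have it : t \in `[0, 1] by rewrite in_itv.
  by have /andP[t0 _] := t01; exact: (ler0_derive1_le_cc W'_exists W'_le0 cW it i0 t0).
have G0 : G 0 = 0 by rewrite /G set_itv1 Rintegral_set1.
have Gt : G t <= G 1.
  case/andP: t01 => t0 t1.
  rewrite -subr_ge0 /G Rintegral_itvB ?bnd_simp//.
  by apply: Rintegral_ge0 => s _; exact: g0.
move: W0; rewrite /W mulr0 expR0 mul1r G0 subr0 lerBlDr => VG.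
have -> : V t = expR (K * t) * (expR (- K * t) * V t).
  by rewrite mulrA -expRD mulNr subrr expR0 mul1r.
have KG : V 0 + G t <= V 0 + G 1 by rewrite lerD2l.
apply: le_trans (ler_wpM2l (expR_ge0 _) (le_trans VG KG)) _.
rewrite ler_wpM2r//.
  by rewrite addr_ge0// Rintegral_ge0.
by rewrite ler_expR; case/andP: t01 => t0 t1; rewrite ler_piMr.
Qed.

End UnitInterval.

(** * Calculus of vector functions through their coordinates *)

Section Derivatives.
Context {R : realType} {p : nat}.
Implicit Types (x y : R -> 'cV[R[i]]_p) (l m : 'cV[R[i]]_p).

Lemma rcoord_is_derive x t l c : has_derivative x t l ->
  is_derive t 1 (fun s => rcoord c (x s)) (rcoord c l).
Proof.
move=> /cvg_rcoord /(_ c) xl.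
have dq : h^-1 *: (((fun s => rcoord c (x s)) \o shift t) (h *: 1) -
    rcoord c (x t)) @[h --> (0 : R)^'] --> rcoord c l.
  apply: cvg_trans xl; apply: near_eq_cvg; apply: nearW => h /=.
  by rewrite /diff_quotient rcoordZ rcoordB /GRing.scale /= mulr1 [h + t]addrC.
by apply: DeriveDef; [apply/cvg_ex; exists (rcoord c l)|exact: cvg_lim].
Qed.

Lemma has_derivative_shift x (a t : R) l :
  has_derivative x (t + a) l -> has_derivative (fun s => x (s + a)) t l.
Proof.
by apply: cvg_trans; apply: near_eq_cvg; apply: nearW => h;
  rewrite /diff_quotient addrAC.
Qed.

Lemma has_derivativeB x y (t : R) l m :
  has_derivative x t l -> has_derivative y t m ->
  has_derivative (fun s => x s - y s) t (l - m).
Proof.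
move=> xl ym; apply: cvg_trans (cvgB xl ym); apply: near_eq_cvg; apply: nearW => h /=.
rewrite -[LHS]/(diff_quotient x t h - diff_quotient y t h).
rewrite /diff_quotient -scalerBr; congr (_ *: _).
by rewrite !opprD !opprK addrACA.
Qed.

Lemma sqnorm_is_derive x t l : has_derivative x t l ->
  is_derive t 1 (fun s => sqnorm (x s))
    (\sum_c 2 * (rcoord c (x t) * rcoord c l)).
Proof.
move=> xl; rewrite /sqnorm.
elim: (index_enum _) => [|c s IH].
  by rewrite big_nil; under eq_fun do rewrite big_nil; exact: is_derive_cst.
rewrite big_cons; under eq_fun do rewrite big_cons.
apply: is_deriveD; have dc := rcoord_is_derive c xl.
under eq_fun do rewrite expr2.
by apply: is_derive_eq; rewrite /GRing.scale /=; ring.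
Qed.

(** Young's inequality [2ab <= a^2 + b^2] turns the derivative of [sqnorm \o x],
    which is bilinear in [x] and [x'], into a form to which Grönwall's
    inequality applies. *)
Lemma sqnorm_derive_le l m :
  \sum_c 2 * (rcoord c l * rcoord c m) <= sqnorm l + sqnorm m.
Proof.
rewrite -big_split; apply: ler_sum => c _ /=.
rewrite -subr_ge0 (_ : _ - _ = (rcoord c l - rcoord c m) ^+ 2) ?sqr_ge0//.
by ring.
Qed.

End Derivatives.

Section SquaredNormIntegral.
Context {R : realType} {p : nat}.
Notation mu := (@lebesgue_measure R).
Implicit Types (g h w : R -> 'cV[R[i]]_p).

Lemma measurable_sqnormB (D : set R) g w :
  (forall c, measurable_fun D (fun s => rcoord c (g s))) ->
  (forall c, measurable_fun D (fun s => rcoord c (w s))) ->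
  measurable_fun D (fun s => sqnorm (g s - w s)).
Proof.
move=> mg mw; apply: measurable_sum => c; apply: measurable_funX.
rewrite [X in measurable_fun _ X](_ : _ =
  (fun s => rcoord c (g s)) \- (fun s => rcoord c (w s))).
  exact: measurable_funB.
by apply/funext => s; rewrite rcoordB.
Qed.

Lemma normr_sqnormB_le (u v : 'cV[R[i]]_p) (M : R) :
  sqnorm u <= M -> sqnorm v <= M -> `|sqnorm (u - v)| <= 4 * M.
Proof.
move=> uM vM; rewrite ger0_norm ?sqnorm_ge0//.
by apply: le_trans (sqnormD_le _ _) _; rewrite sqnormN; lra.
Qed.

Lemma cvg_integral_sqnorm (g : nat -> R -> 'cV[R[i]]_p) h w (M : R) :
  (forall j c, measurable_fun `[0 : R, 1] (fun s => rcoord c (g j s))) ->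
  (forall c, measurable_fun `[0 : R, 1] (fun s => rcoord c (w s))) ->
  (forall j s, sqnorm (g j s) <= M) -> (forall s, sqnorm (w s) <= M) ->
  (forall s, g j s @[j --> \oo] --> h s) ->
  \int[mu]_(s in `[0 : R, 1]) sqnorm (g j s - w s) @[j --> \oo] -->
  \int[mu]_(s in `[0 : R, 1]) sqnorm (h s - w s).
Proof.
move=> mg mw gM wM gh.
apply: (@bounded_cvg_unit _ (fun j s => sqnorm (g j s - w s)) _ (4 * M)).
- by move=> j; exact: measurable_sqnormB.
- by move=> j s; exact: normr_sqnormB_le.
- by move=> s; apply: cvg_sqnorm; apply: cvgB; [exact: gh|exact: cvg_cst].
Qed.

(** A Cauchy criterion with an iterated limit: if the distance of [u j] to [u k]
    is at most [Q j k], it suffices that the limit of [Q j k] in [j] tends to 0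
    with [k].  This is the form in which the stability estimate delivers its
    bound. *)
Lemma sqnorm_cauchy_cvg (u : nat -> 'cV[R[i]]_p) (Q : nat -> nat -> R) (q : nat -> R) :
  (forall j k, sqnorm (u j - u k) <= Q j k) ->
  (forall k, Q j k @[j --> \oo] --> q k) ->
  q k @[k --> \oo] --> 0 ->
  exists l : 'cV[R[i]]_p, u j @[j --> \oo] --> l.
Proof.
move=> uQ Qq q0.
have cu c : cvg (rcoord c (u j) @[j --> \oo]).
  apply/cauchy_cvgP; apply: cauchy_exP => e e0.
  have e20 : 0 < e ^+ 2 by rewrite exprn_gt0.
  have [k qk] : exists k, q k < e ^+ 2.
    have /cvgr0Pnorm_lt /(_ _ e20) [k _ /(_ k (leqnn k)) /= qk] := q0.
    by exists k; apply: le_lt_trans qk; exact: ler_norm.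
  exists (rcoord c (u k)).
  have : \forall j \near \oo, Q j k < e ^+ 2.
    exact: (cvgr_lt (q k) (Qq k)).
  apply: filterS => j /= Qjk; rewrite /ball /= distrC -rcoordB.
  rewrite -(@ltr_pXn2r _ 2)// ?nnegrE ?(ltW e0)// real_normK ?num_real//.
  exact: le_lt_trans (le_trans (sqr_rcoord_le c _) (uQ j k)) Qjk.
have [l lE] := exists_rcoord (fun c => lim (rcoord c (u j) @[j --> \oo])).
by exists l; apply: rcoord_cvg => c; rewrite lE; exact: cu.
Qed.

End SquaredNormIntegral.

(** * Stability of solutions on one cell *)

Lemma cvg_shift {R : realType} {T : topologicalType} (g : R -> T) (s a : R) :
  {for s + a, continuous g} -> g (r + a) @[r --> s] --> g (s + a).
Proof.
move=> cg; apply: (cvg_comp (fun r : R => r + a) g _ cg).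
by apply: cvgD; [exact: cvg_id|exact: cvg_cst].
Qed.

Section Solutions.
Context {R : realType} {p : nat}.
Context (A B : 'M[R[i]]_p) (f x : R -> 'cV[R[i]]_p).
Context (hf : BPC f) (hx : DEPCA_solution A B f x).
Notation mu := (@lebesgue_measure R).
Implicit Types (a b n : int) (s t : R).

Lemma BPC_sqnorm_bounded : exists2 M, 0 <= M & forall t, sqnorm (f t) <= M.
Proof. by have [fb _ _] := hf; exact: bounded_sqnorm. Qed.

Lemma shift_unit_not_int n s : s \in `]0, 1[ -> s + n%:~R \isn't a Num.int.
Proof.
rewrite in_itv /= => /andP[s0 s1]; apply/negP => /intrP[m] /esym/eqP.
rewrite -subr_eq -intrB => /eqP ms; move: s0 s1; rewrite -ms ltr0z ltrz1.
by rewrite gtz0_ge1 => /le_lt_trans/[apply]; rewrite ltxx.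
Qed.

Lemma floor_shift_unit n s : s \in `]0, 1[ -> Num.floor (s + n%:~R) = n.
Proof.
rewrite in_itv /= => /andP[s0 s1]; apply: floor_def.
by rewrite lerDr (ltW s0) intrD [s + _]addrC ltrD2l.
Qed.

Lemma BPC_continuous_shift n s : s \in `]0, 1[ ->
  f (r + n%:~R) @[r --> s] --> f (s + n%:~R).
Proof.
move=> s01; have [_ + _] := hf => /(_ _ (shift_unit_not_int n s01)) fc.
exact: cvg_shift.
Qed.

(** The shifted function is continuous inside the unit interval, and the two
    endpoints are negligible for measurability. *)
Lemma BPC_measurable_shift n c :
  measurable_fun `[0 : R, 1] (fun s => rcoord c (f (s + n%:~R))).
Proof.
apply: (@measurable_fun_itv_cc _ 0 1 false true).
apply: open_continuous_measurable_fun; first exact: interval_open.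
by move=> s /set_mem s01; apply: cvg_rcoord; exact: BPC_continuous_shift.
Qed.

Lemma solution_has_derivative n s : s \in `]0, 1[ ->
  has_derivative x (s + n%:~R)
    (A *m x (s + n%:~R) + B *m x n%:~R + f (s + n%:~R)).
Proof.
move=> s01; have [_ _ _ + _] := hx => /(_ n (s + n%:~R)).
rewrite /DEPCA_rhs floor_shift_unit//; apply.
move: s01; rewrite in_itv /= => /andP[s0 s1].
by rewrite ltrDr s0 intrD [s + _]addrC ltrD2l.
Qed.

(** The key estimate.  On a cell, where [x [t]] is constant, the difference [d]
    of two integer shifts of [x] solves
    [d' = A d + B (x a - x b) + (f (s + a) - f (s + b))], so Grönwall's
    inequality controls it by its initial value and the integral of the forcing
    term.  That [C] does not depend on the shifts allows passing to the limit
    in [a] and [b]. *)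
Lemma solution_stability : exists2 C, 0 <= C & forall a b t, 0 <= t <= 1 ->
  sqnorm (x (t + a%:~R) - x (t + b%:~R)) <=
  C * (sqnorm (x a%:~R - x b%:~R) +
       \int[mu]_(s in `[0, 1]) sqnorm (f (s + a%:~R) - f (s + b%:~R))).
Proof.
have [KA KA0 AK] := sqnorm_mulmx_le A.
have [KB KB0 BK] := sqnorm_mulmx_le B.
have [M M0 fM] := BPC_sqnorm_bounded.
have cx : continuous x by have [] := hx.
exists (expR (1 + 4 * KA) * (3 + 4 * KB)) => [|a b t t01].
  by rewrite mulr_ge0 ?expR_ge0// addr_ge0// mulr_ge0.
set c := sqnorm (x a%:~R - x b%:~R).
have c0 : 0 <= c by exact: sqnorm_ge0.
pose h s := sqnorm (f (s + a%:~R) - f (s + b%:~R)).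
pose d s := x (s + a%:~R) - x (s + b%:~R).
pose l s := (A *m x (s + a%:~R) + B *m x a%:~R + f (s + a%:~R)) -
            (A *m x (s + b%:~R) + B *m x b%:~R + f (s + b%:~R)).
(* The term with [B] does not depend on [s] and is part of the forcing; the
   factors 4, 4 and 2 come from splitting a sum of three by [sqnormD_le]. *)
pose g s := 4 * KB * c + 2 * h s.
have h0 s : 0 <= h s by exact: sqnorm_ge0.
have g0 s : 0 <= g s by rewrite addr_ge0// mulr_ge0// mulr_ge0.
have hM s : `|h s| <= 4 * M by exact: normr_sqnormB_le.
have mh : measurable_fun `[0 : R, 1] h.
  by apply: measurable_sqnormB => k; exact: BPC_measurable_shift.
have ih := integrable_unit mh hM.
have ch s : s \in `]0, 1[ -> {for s, continuous h}.
  by move=> s01; apply: cvg_sqnorm; apply: cvgB; exact: BPC_continuous_shift.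
have mg : measurable_fun `[0 : R, 1] g.
  by apply: measurable_funD => //; apply: measurable_funM.
have gM s : `|g s| <= 4 * KB * c + 2 * (4 * M).
  rewrite ger0_norm// lerD2l ler_pM2l//; apply: le_trans (hM s).
  by rewrite ler_norm.
have dl s : s \in `]0, 1[ -> has_derivative d s (l s).
  move=> s01; apply: has_derivativeB; apply: has_derivative_shift;
  exact: solution_has_derivative.
have lE s : sqnorm (l s) <= 4 * KA * sqnorm (d s) + g s.
  have -> : l s = A *m d s + B *m (x a%:~R - x b%:~R) +
      (f (s + a%:~R) - f (s + b%:~R)).
    by rewrite /l /d !mulmxBr !opprD addrACA [X in X + _ = _]addrACA.
  apply: le_trans (sqnormD_le _ _) _.
  have := sqnormD_le (A *m d s) (B *m (x a%:~R - x b%:~R)).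
  have := AK (d s); have := BK (x a%:~R - x b%:~R).
  rewrite -/(h s) -/c /g; lra.
have Vt : sqnorm (d t) <= expR (1 + 4 * KA) *
    (sqnorm (d 0) + \int[mu]_(s in `[0, 1]) g s).
  apply: (@gronwall_unit R (fun s => sqnorm (d s))
    (fun s => \sum_k 2 * (rcoord k (d s) * rcoord k (l s)))) => //.
  - by rewrite addr_ge0// mulr_ge0.
  - exact: sqnorm_ge0.
  - apply: continuous_subspaceT => s; apply: cvg_sqnorm.
    by apply: cvgB; apply: cvg_shift; exact: cx.
  - by move=> s /dl /sqnorm_is_derive.
  - move=> s _; apply: le_trans (sqnorm_derive_le _ _) _.
    by rewrite mulrDl mul1r -addrA lerD2l.
  - move=> s /ch hs; apply: cvgD; first exact: cvg_cst.
    by apply: cvgM; [exact: cvg_cst|exact: hs].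
  - exact: integrable_unit mg gM.
apply: le_trans Vt _; rewrite -mulrA ler_wpM2l ?expR_ge0//.
have -> : sqnorm (d 0) = c by rewrite /d !add0r.
have -> : \int[mu]_(s in `[0, 1]) g s =
    4 * KB * c + 2 * \int[mu]_(s in `[0, 1]) h s.
  rewrite RintegralD//.
  - rewrite Rintegral_cst//= lebesgue_measure_itv /= lte01 oppr0 adde0 mulr1.
    by rewrite RintegralZl.
  - exact: (integrable_unit (g := cst _) (M := `|4 * KB * c|)).
  - apply: (integrable_unit (g := fun s => 2 * h s) (M := 2 * (4 * M))).
      exact: measurable_funM.
    by move=> s; rewrite normrM ger0_norm// ler_pM2l.
have I0 : 0 <= \int[mu]_(s in `[0, 1]) h s by apply: Rintegral_ge0.
set I := \int[mu]_(_ in _) _ in I0 *.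
have := mulr_ge0 KB0 I0; lra.
Qed.

End Solutions.

(** * Lipschitz continuity of bounded solutions *)

Section Equicontinuity.
Context {R : realType} {p : nat}.
Context (A B : 'M[R[i]]_p) (f x : R -> 'cV[R[i]]_p).
Context (hf : BPC f) (hxb : bounded_fun x) (hx : DEPCA_solution A B f x).
Implicit Types (n : int) (s t : R).

(** The right-hand side of the equation is bounded because [x] and [f] are;
    the mean value theorem is applied to each real coordinate. *)
Lemma solution_unit_lipschitz : exists2 L, 0 <= L & forall n s t,
  0 <= s -> s <= t -> t <= 1 ->
  sqnorm (x (t + n%:~R) - x (s + n%:~R)) <= L * (t - s) ^+ 2.
Proof.
have [KA KA0 AK] := sqnorm_mulmx_le A.
have [KB KB0 BK] := sqnorm_mulmx_le B.
have [M M0 fM] := BPC_sqnorm_bounded hf.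
have [X X0 xX] := bounded_sqnorm hxb.
have cx : continuous x by have [] := hx.
pose L := 4 * (KA * X) + 4 * (KB * X) + 2 * M.
have L0 : 0 <= L by rewrite !addr_ge0// mulr_ge0// mulr_ge0.
exists (\sum_(k : bool * 'I_p) L) => [|n s t s0 st t1]; first exact: sumr_ge0.
rewrite mulr_suml; apply: ler_sum => k _; rewrite rcoordB.
pose l r := A *m x (r + n%:~R) + B *m x n%:~R + f (r + n%:~R).
have lL r : sqnorm (l r) <= L.
  apply: le_trans (sqnormD_le _ _) _.
  have := sqnormD_le (A *m x (r + n%:~R)) (B *m x n%:~R).
  have := AK (x (r + n%:~R)); have := BK (x n%:~R).
  have := ler_wpM2l KA0 (xX (r + n%:~R)); have := ler_wpM2l KB0 (xX n%:~R).
  have := fM (r + n%:~R); rewrite /L; lra.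
have [||c _ ->] := @MVT_segment R (fun r => rcoord k (x (r + n%:~R)))
  (fun r => rcoord k (l r)) s t st.
- move=> r rst; apply: (rcoord_is_derive (x := fun r => x (r + n%:~R))).
  apply: has_derivative_shift; apply: (solution_has_derivative hx).
  move: rst; rewrite !in_itv /= => /andP[sr rt].
  by rewrite (le_lt_trans s0 sr) (lt_le_trans rt t1).
- apply: continuous_subspaceT => r; apply: cvg_rcoord; apply: cvg_shift.
  exact: cx.
by rewrite exprMn ler_wpM2r ?sqr_ge0// (le_trans (sqr_rcoord_le _ _) (lL c)).
Qed.

(** The points [s <= t] lie in one cell, or are separated by the single integer
    [floor t], or are at distance at least 1, where boundedness of [x] is
    enough. *)
Lemma solution_lipschitz : exists2 L, 0 <= L & forall s t,
  sqnorm (x t - x s) <= L * (t - s) ^+ 2.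
Proof.
have [L L0 xL] := solution_unit_lipschitz.
have [X X0 xX] := bounded_sqnorm hxb.
exists (2 * L + 4 * X) => [|s t]; first by rewrite addr_ge0// mulr_ge0.
wlog st : s t / s <= t => [hwlog|].
  have [/hwlog//|/ltW/hwlog] := leP s t.
  by rewrite sqnormBC -[s - t]opprB sqrrN.
have LX : 0 <= 2 * L /\ 0 <= 4 * X by rewrite !mulr_ge0.
have [ts1|ts1] := leP 1 (t - s).
  apply: (@le_trans _ _ (4 * X)).
    by apply: le_trans (sqnormD_le _ _) _; rewrite sqnormN;
       have := xX s; have := xX t; lra.
  have e1 : 1 <= (t - s) ^+ 2 by rewrite -[leLHS](expr1n R 2) lerXn2r ?nnegrE//; lra.
  have := ler_wpM2l (proj2 LX) e1.
  have := ler_wpM2l (proj1 LX) e1; lra.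
pose n := Num.floor t.
have /andP[nt tn] := floor_itv t.
have cell m r q : m%:~R <= r -> r <= q -> q <= m%:~R + 1 ->
    sqnorm (x q - x r) <= L * (q - r) ^+ 2.
  move=> mr rq qm; have := xL m (r - m%:~R) (q - m%:~R).
  rewrite !subrK (_ : q - _ - _ = q - r); last by ring.
  by apply; rewrite ?subr_ge0 ?lerD2r// lerBlDl.
have XS : 0 <= 4 * X * (t - s) ^+ 2 by rewrite mulr_ge0 ?sqr_ge0//; case: LX.
have tn1 : t <= n%:~R + 1 by move: tn; rewrite intrD => /ltW.
have [ns|sn] := leP n%:~R s.
  have := cell n s t ns st tn1.
  have : 0 <= L * (t - s) ^+ 2 by rewrite mulr_ge0 ?sqr_ge0.
  by lra.
have c1 := cell n _ _ (lexx _) nt tn1.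
have c2 : sqnorm (x n%:~R - x s) <= L * (n%:~R - s) ^+ 2.
  by apply: (cell (n - 1)); rewrite ?intrB ?subrK ?(ltW sn)//; lra.
have := sqnormB_le (x t) (x n%:~R) (x s).
have : L * (t - n%:~R) ^+ 2 + L * (n%:~R - s) ^+ 2 <= L * (t - s) ^+ 2.
  by rewrite -mulrDr ler_wpM2l//; nra.
lra.
Qed.

End Equicontinuity.

(** * Limits of solutions along integer shifts *)

Section IntegerShifts.
Context {R : realType} {p : nat}.
Context (A B : 'M[R[i]]_p) (f x : R -> 'cV[R[i]]_p).
Context (hf : BPC f) (hx : DEPCA_solution A B f x).
Context (m : nat -> int) (ft : R -> 'cV[R[i]]_p) (xt : int -> 'cV[R[i]]_p).
Context (fft : forall t, f (t + (m j)%:~R) @[j --> \oo] --> ft t).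
Context (ftf : forall t, ft (t - (m j)%:~R) @[j --> \oo] --> f t).
Context (xxt : forall k : int, x (k + m j)%:~R @[j --> \oo] --> xt k).
Context (xtx : forall k : int, xt (k - m j) @[j --> \oo] --> x k%:~R).
Notation mu := (@lebesgue_measure R).
Implicit Types (a b n k : int) (s t : R).

Lemma cvg_shift_shift s n : f (s + (n + m j)%:~R) @[j --> \oo] --> ft (s + n%:~R).
Proof. by under eq_fun do rewrite intrD addrA; exact: fft. Qed.

Lemma limit_measurable_shift n c :
  measurable_fun `[0 : R, 1] (fun s => rcoord c (ft (s + n%:~R))).
Proof.
apply: (measurable_fun_cvg (h := fun j s => rcoord c (f (s + (n + m j)%:~R)))).
  by move=> j; exact: BPC_measurable_shift.
by move=> s _; apply: cvg_rcoord; exact: cvg_shift_shift.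
Qed.

Lemma limit_bounded (M : R) :
  (forall t, sqnorm (f t) <= M) -> forall t, sqnorm (ft t) <= M.
Proof.
move=> fM t; apply: (ler_cvg_to (cvg_sqnorm (@fft t)) (cvg_cst M)).
by near=> j; exact: fM.
Unshelve. all: by end_near. Qed.

(** Passage to the limit in the bound of [solution_stability], the first shift
    running along [n + m j]. *)
Lemma stability_rhs_cvg n b :
  sqnorm (x (n + m j)%:~R - x b%:~R) +
    \int[mu]_(s in `[0 : R, 1]) sqnorm (f (s + (n + m j)%:~R) - f (s + b%:~R))
  @[j --> \oo] -->
  sqnorm (xt n - x b%:~R) +
    \int[mu]_(s in `[0 : R, 1]) sqnorm (ft (s + n%:~R) - f (s + b%:~R)).
Proof.
have [M M0 fM] := BPC_sqnorm_bounded hf.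
have hx0 : sqnorm (x (n + m j)%:~R - x b%:~R) @[j --> \oo] -->
    sqnorm (xt n - x b%:~R).
  by apply: cvg_sqnorm; apply: cvgB; [exact: xxt|exact: cvg_cst].
have hf0 := cvg_integral_sqnorm (fun j c => BPC_measurable_shift hf (n + m j) c)
  (fun c => BPC_measurable_shift hf b c) (fun j s => fM _) (fun s => fM _)
  (fun s => @cvg_shift_shift s n).
exact: cvgD hx0 hf0.
Qed.

(** Stability makes [x (t + m j)] a Cauchy sequence.  Letting the first shift of
    the stability estimate tend to its limit bounds the distance of
    [y (s + a)] to [x (s + b)] for all integers [a] and [b]; with [a = n - m j]
    and [b = n] that bound tends to 0, which gives the return to [x]. *)
Lemma solution_integer_shift : exists y : R -> 'cV[R[i]]_p,
  (forall t, x (t + (m j)%:~R) @[j --> \oo] --> y t) /\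
  (forall t, y (t - (m j)%:~R) @[j --> \oo] --> x t).
Proof.
have [M M0 fM] := BPC_sqnorm_bounded hf.
have [C C0 xC] := solution_stability hf hx.
have cell t : exists n (s : R), 0 <= s <= 1 /\ t = s + n%:~R.
  exists (Num.floor t), (t - (Num.floor t)%:~R); rewrite subrK; split=> //.
  have /andP[nt tn] := floor_itv t.
  by rewrite subr_ge0 nt lerBlDl; move: tn; rewrite intrD => /ltW.
pose rhs n b := C * (sqnorm (xt n - x b%:~R) +
    \int[mu]_(s in `[0 : R, 1]) sqnorm (ft (s + n%:~R) - f (s + b%:~R))).
have /boolp.choice[y xy] : forall t, exists l : 'cV[R[i]]_p,
    x (t + (m j)%:~R) @[j --> \oo] --> l.
  move=> t; have [n [s [s01 ->]]] := cell t.
  pose Q j i := C * (sqnorm (x (n + m j)%:~R - x (n + m i)%:~R) +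
    \int[mu]_(r in `[0 : R, 1])
      sqnorm (f (r + (n + m j)%:~R) - f (r + (n + m i)%:~R))).
  have uQ j i : sqnorm (x (s + n%:~R + (m j)%:~R) - x (s + n%:~R + (m i)%:~R))
      <= Q j i.
    by rewrite -!addrA -!intrD; exact: xC.
  have Qq i : Q j i @[j --> \oo] --> rhs n (n + m i).
    by apply: cvgM; [exact: cvg_cst|exact: stability_rhs_cvg].
  have q0 : rhs n (n + m i) @[i --> \oo] --> 0.
    have xt0 : sqnorm (xt n - x (n + m i)%:~R) @[i --> \oo] --> 0.
      under eq_fun do rewrite sqnormBC.
      by apply/cvg_sqnormP; exact: xxt.
    have := cvg_integral_sqnorm
      (fun j c => BPC_measurable_shift hf (n + m j) c)
      (fun c => limit_measurable_shift n c) (fun j s => fM _)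
      (fun s => limit_bounded fM _) (fun s => @cvg_shift_shift s n).
    under [X in _ --> X -> _]eq_Rintegral do rewrite subrr sqnorm0.
    rewrite Rintegral_cst// mul0r => ft0.
    rewrite -(mulr0 C) -(addr0 0); apply: cvgM; first exact: cvg_cst.
    apply: cvgD xt0 _; apply: cvg_trans ft0; apply: near_eq_cvg.
    by apply: nearW => i; apply: eq_Rintegral => r _; rewrite sqnormBC.
  exact: sqnorm_cauchy_cvg uQ Qq q0.
exists y; split; first exact: xy.
move=> t; have [n [s [s01 ->]]] := cell t.
have yx a b : sqnorm (y (s + a%:~R) - x (s + b%:~R)) <= rhs a b.
  have yl : sqnorm (x (s + a%:~R + (m j)%:~R) - x (s + b%:~R)) @[j --> \oo] -->
      sqnorm (y (s + a%:~R) - x (s + b%:~R)).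
    by apply: cvg_sqnorm; apply: cvgB; [exact: xy|exact: cvg_cst].
  apply: (ler_cvg_to yl (cvgM (cvg_cst C) (@stability_rhs_cvg a b))).
  by near=> j; rewrite -addrA -intrD; exact: xC.
have r0 : rhs (n - m j) n @[j --> \oo] --> 0.
  have xt0 : sqnorm (xt (n - m j) - x n%:~R) @[j --> \oo] --> 0.
    by apply/cvg_sqnormP; exact: xtx.
  have ftfn r : ft (r + (n - m j)%:~R) @[j --> \oo] --> f (r + n%:~R).
    by under eq_fun do rewrite intrB addrA; exact: ftf.
  have := cvg_integral_sqnorm
    (fun j c => limit_measurable_shift (n - m j) c)
    (fun c => BPC_measurable_shift hf n c) (fun j s => limit_bounded fM _)
    (fun s => fM _) ftfn.
  under [X in _ --> X -> _]eq_Rintegral do rewrite subrr sqnorm0.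
  rewrite Rintegral_cst// mul0r => ft0.
  rewrite -(mulr0 C) -(addr0 0); apply: cvgM; first exact: cvg_cst.
  exact: cvgD xt0 ft0.
by apply: (cvg_sqnorm_le r0) => j; rewrite -addrA -intrB; exact: yx.
Unshelve. all: by end_near. Qed.

End IntegerShifts.

(** * From integer shifts to real shifts *)

Section RealShifts.
Context {R : realType} {p : nat}.
Implicit Types (x y : R -> 'cV[R[i]]_p).

Lemma cvg_subsequence {T : topologicalType} (u : nat -> T) (l : T) phi :
  increasing_seq phi -> u n @[n --> \oo] --> l -> u (phi n) @[n --> \oo] --> l.
Proof.
move=> phi_incr; apply: cvg_comp => A [N _ NA]; exists N => // n Nn.
apply: NA => /=; apply: leq_trans Nn _; elim: n => // n IH.
by apply: leq_ltn_trans IH _; move/increasing_seqP : phi_incr; exact.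
Qed.

Lemma almost_automorphic_discrete x :
  almost_automorphic x -> discrete_almost_automorphic (fun n : int => x n%:~R).
Proof.
move=> [_ _ xaa] s'; have [phi [xt [phi_incr xxt xtx]]] := xaa (fun n => (s' n)%:~R).
exists phi, (fun k => xt k%:~R); split=> // k /=.
  by under eq_fun do rewrite intrD; exact: xxt.
by under eq_fun do rewrite intrB; exact: xtx.
Qed.

(** A real shift is its floor plus a fractional part.  Along a subsequence the
    fractional parts [xi n] converge to some [sigma], by Bolzano-Weierstrass,
    and the floors produce a limit [y] of [x]; the limit along the real shifts
    is then [y] translated by [sigma].  Replacing [xi n] by [sigma] costs
    [L * (xi n - sigma)^2], for [x] and, since the Lipschitz bound survives the
    limit, for [y]. *)
Lemma lipschitz_almost_automorphic x (L : R) :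
  bounded_fun x -> continuous x ->
  (forall s t, sqnorm (x t - x s) <= L * (t - s) ^+ 2) ->
  (forall s' : nat -> int, exists (phi : nat -> nat) (y : R -> 'cV[R[i]]_p),
    [/\ increasing_seq phi,
        forall t, x (t + (s' (phi n))%:~R) @[n --> \oo] --> y t &
        forall t, y (t - (s' (phi n))%:~R) @[n --> \oo] --> x t]) ->
  almost_automorphic x.
Proof.
move=> xb cx xL xZ; split=> // s'.
pose xi n := s' n - (Num.floor (s' n))%:~R.
have [phi0 phi0_incr /cvg_ex[/= sigma xi_sigma]] :
    exists2 phi : nat -> nat, increasing_seq phi & cvgn (xi \o phi).
  apply: bolzano_weierstrass; exists 1; split=> // M M1 n _.
  have /andP[fl fu] := floor_itv (s' n).
  rewrite /= ger0_norm /xi ?subr_ge0//; apply: le_trans (ltW M1).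
  by rewrite lerBlDl; move: fu; rewrite intrD => /ltW.
have [phi1 [y [phi1_incr xy yx]]] := xZ (fun n => Num.floor (s' (phi0 n))).
pose phi := phi0 \o phi1; pose m n := Num.floor (s' (phi n)).
have s'E n : s' (phi n) = (m n)%:~R + xi (phi n) by rewrite /xi addrC subrK.
have yL s t : sqnorm (y t - y s) <= L * (t - s) ^+ 2.
  apply: (ler_cvg_to (cvg_sqnorm (cvgB (xy t) (xy s))) (cvg_cst _)).
  near=> n; apply: le_trans (xL _ _) _.
  by rewrite (_ : _ - (s + _) = t - s)//; ring.
have bound0 (r : nat -> R) : r n @[n --> \oo] --> 0 ->
    2 * (L * (xi (phi n) - sigma) ^+ 2) + 2 * r n @[n --> \oo] --> 0.
  move=> r0; have xi0 : xi (phi n) - sigma @[n --> \oo] --> 0.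
    rewrite -(subrr sigma); apply: cvgB; last exact: cvg_cst.
    exact: (cvg_subsequence phi1_incr xi_sigma).
  have := cvgD (cvgM (cvg_cst (2 : R)) (cvgM (cvg_cst L) (cvg_sqr xi0)))
    (cvgM (cvg_cst (2 : R)) r0).
  by rewrite expr0n /= !mulr0 addr0; apply.
exists phi, (fun t => y (t + sigma)); split=> [|t|t].
- by move=> i j; apply: etrans (phi0_incr _ _) (phi1_incr _ _).
- have xs0 : sqnorm (x (t + sigma + (m n)%:~R) - y (t + sigma)) @[n --> \oo] --> 0.
    by apply/cvg_sqnormP; exact: xy.
  apply: (cvg_sqnorm_le (bound0 _ xs0)) => n.
  apply: le_trans (sqnormB_le _ (x (t + sigma + (m n)%:~R)) _) _.
  rewrite lerD2r ler_pM2l//; apply: le_trans (xL _ _) _.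
  by rewrite s'E (_ : _ - _ = xi (phi n) - sigma)//; ring.
- have ys0 : sqnorm (y (t - (m n)%:~R) - x t) @[n --> \oo] --> 0.
    by apply/cvg_sqnormP; exact: yx.
  apply: (cvg_sqnorm_le (bound0 _ ys0)) => n.
  apply: le_trans (sqnormB_le _ (y (t - (m n)%:~R)) _) _.
  rewrite lerD2r ler_pM2l//; apply: le_trans (yL _ _) _.
  by rewrite s'E (_ : _ + sigma - _ = - (xi (phi n) - sigma)) ?sqrrN//; ring.
Unshelve. all: by end_near. Qed.

End RealShifts.

Theorem theorem4p7 (R : realType) (p : nat)
  (f : R -> 'cV[R[i]]_p) (A B : 'M[R]_p) (x : R -> 'cV[R[i]]_p)
  (hf : Z_almost_automorphic f)
  (hAB : simultaneously_triangularizable (complex_mx A) (complex_mx B))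
  (hev : forall lA lB : R[i],
     eigenvalue (complex_mx A) lA -> eigenvalue (complex_mx B) lB ->
     forall u : R, 0 <= u <= 1 ->
       (lA != 0 -> lB / lA * (1 - cexp (- (u%:C * lA))) != -1) /\
       (lA = 0 -> lB * u%:C != -1))
  (hxb : bounded_fun x)
  (hx : DEPCA_solution (complex_mx A) (complex_mx B) f x) :
  almost_automorphic x <->
  discrete_almost_automorphic (fun n : int => x n%:~R).
Proof.
split=> [|xd]; first exact: almost_automorphic_discrete.
have [fBPC fZ] := hf.
have cx : continuous x by case: hx.
have [L _ xL] := solution_lipschitz fBPC hxb hx.
apply: (lipschitz_almost_automorphic hxb cx xL) => s'.
have [phi1 [ft [phi1_incr fft ftf]]] := fZ s'.
have [phi2 [xt [phi2_incr xxt xtx]]] := xd (s' \o phi1).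
have [y [xy yx]] := solution_integer_shift fBPC hx
  (m := fun n => s' (phi1 (phi2 n))) (ft := ft) (xt := xt)
  (fun t => cvg_subsequence phi2_incr (fft t))
  (fun t => cvg_subsequence phi2_incr (ftf t)) xxt xtx.
exists (phi1 \o phi2), y; split=> [i j||].
- by apply: etrans (phi1_incr _ _) (phi2_incr _ _).
- exact: xy.
- exact: yx.
Qed.
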